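(* Let $G=\{g_1,\ldots,g_n\}$ be a finite abelian group of order $n$, with irreducible complex characters $\chi_1,\ldots,\chi_n$ ordered so that $\{\chi_1,\ldots,\chi_k\}$ is a maximal subset of irreducible characters which are pairwise not algebraically conjugate, and let $q_i$ be the order of $\chi_i$. Let $\phi:\mathbb{Q}G\to\mathbb{Q}(\zeta_{q_1})\oplus\cdots\oplus\mathbb{Q}(\zeta_{q_k})$ be the map $h\mapsto(\chi_1(h),\ldots,\chi_k(h))$. Then the restriction of $\phi$ to $\mathbb{Z}G$ gives a $\mathbb{Z}$-algebra homomorphism $$\psi:\mathbb{Z}G\hookrightarrow\mathbb{Z}[\zeta_{q_1}]\oplus\cdots\oplus\mathbb{Z}[\zeta_{q_k}],$$ which is injective. If $h=\sum_{i=1}^n h_ig_i\in\mathbb{Z}G$, then $\psi(h)=(c_1,\ldots,c_k)$, where $$\begin{pmatrix}c_1\\ \vdots\\ c_k\end{pmatrix}=B\begin{pmatrix}h_1\\ \vdots\\ h_n\end{pmatrix}.$$ If $(c_1,\ldots,c_k)\in\psi(\mathbb{Z}G)$, then $\psi^{-1}((c_1,\ldots,c_k))=\sum_{i=1}^n h_ig_i$, where, setting $c_i=\sigma_i(c_{k_i})$ for $k<i\le n$, $$\begin{pmatrix}h_1\\ \vdots\\ h_n\end{pmatrix}=A^{-1}\begin{pmatrix}c_1\\ \vdots\\ c_n\end{pmatrix}.$$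
   Context: Characters of $G$ are homomorphisms $G\to\mathbb{C}^{*}$, extended linearly to the group ring; there are exactly $n$ irreducible ones. For a positive integer $q$, $\zeta_q$ denotes a primitive $q$-th root of unity in $\mathbb{C}$. The order $q_i$ of $\chi_i$ is its order in the character group $\widehat{G}$, so $\chi_i$ takes values in $\mathbb{Q}(\zeta_{q_i})$ on $\mathbb{Q}G$. Two characters $\chi_i,\chi_j$ with values in some Galois number field $K$ are algebraically conjugate if there is an automorphism $\sigma$ of $K$ with $\chi_j=\sigma(\chi_i)$ (that is, $\chi_j(g)=\sigma(\chi_i(g))$ for all $g\in G$). For each $i$ with $k<i\le n$, $k_i$ denotes the unique index with $1\le k_i\le k$ such that $\chi_i$ and $\chi_{k_i}$ are algebraically conjugate, and $\sigma_i$ is the automorphism of $\mathbb{Q}(\zeta_{q_{k_i}})$ such that $\sigma_i(\chi_{k_i})=\chi_i$. $A=(\chi_i(g_j))_{i,j=1,\ldots,n}$ is the character matrix of $G$ (it is invertible), and $B$ is the $k\times n$ matrix made of the first $k$ rows of $A$. *)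

(* Defs.v *)
From HB Require Import structures.
From mathcomp Require Import all_boot all_order all_algebra all_fingroup.
From mathcomp Require Import all_solvable all_field all_character.
From mathcomp Require Import boolp.

Set Implicit Arguments.
Unset Strict Implicit.
Unset Printing Implicit Defensive.

Import Order.TTheory GroupScope GRing.Theory Num.Theory.
Local Open Scope ring_scope.

(* The group ring R[gT]: an element is the family of its coefficients, and the
   product is convolution (not the pointwise product of {ffun gT -> R}). *)
Definition group_alg (R : pzRingType) (gT : finGroupType) := {ffun gT -> R}.

Section GroupAlg.
Variables (R : pzRingType) (gT : finGroupType).
Local Notation RG := (group_alg R gT).

HB.instance Definition _ := GRing.Zmodule.on RG.

Definition galg_elt (x : gT) : RG := [ffun y => (y == x)%:R].

Definition galg_mul (a b : RG) : RG :=
  [ffun x : gT => \sum_(y : gT) a y * b (y^-1 * x)%g].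

Definition galg_scale (c : R) (a : RG) : RG := [ffun x => c * a x].

Fact galg_mulA : associative galg_mul.
Proof.
move=> a b c; apply/ffunP=> x; rewrite !ffunE.
under eq_bigr => y _ do rewrite ffunE mulr_sumr.
under [RHS]eq_bigr => y _ do rewrite ffunE mulr_suml.
rewrite [RHS]exchange_big /=; apply: eq_bigr => y _.
rewrite [RHS](reindex_inj (mulgI y)) /=; apply: eq_bigr => z _.
by rewrite mulKg invMg !mulgA mulrA.
Qed.

Fact galg_mul1 : left_id (galg_elt 1%g) galg_mul.
Proof.
move=> a; apply/ffunP=> x; rewrite ffunE (bigD1 1%g) //= big1 => [|y ny].
  by rewrite ffunE eqxx mul1r invg1 mul1g addr0.
by rewrite ffunE (negPf ny) mul0r.
Qed.

Fact galg_mulr1 : right_id (galg_elt 1%g) galg_mul.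
Proof.
move=> a; apply/ffunP=> x; rewrite ffunE (bigD1 x) //= big1 => [|y ny].
  by rewrite ffunE mulVg eqxx mulr1 addr0.
rewrite ffunE; case: eqP => [e|_]; last by rewrite mulr0.
by case/eqP: ny; rewrite -[y]mulg1 -e mulKVg.
Qed.

Fact galg_mulDl : left_distributive galg_mul +%R.
Proof.
move=> a b c; apply/ffunP=> x; rewrite !ffunE -big_split /=.
by apply: eq_bigr => y _; rewrite ffunE mulrDl.
Qed.

Fact galg_mulDr : right_distributive galg_mul +%R.
Proof.
move=> a b c; apply/ffunP=> x; rewrite !ffunE -big_split /=.
by apply: eq_bigr => y _; rewrite ffunE mulrDr.
Qed.

HB.instance Definition _ := GRing.Zmodule_isPzRing.Build RG
  galg_mulA galg_mul1 galg_mulr1 galg_mulDl galg_mulDr.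

Fact galg_scaleA c d a : galg_scale c (galg_scale d a) = galg_scale (c * d) a.
Proof. by apply/ffunP=> x; rewrite !ffunE mulrA. Qed.
Fact galg_scale1 : left_id 1 galg_scale.
Proof. by move=> a; apply/ffunP=> x; rewrite !ffunE mul1r. Qed.
Fact galg_scaleDr : right_distributive galg_scale +%R.
Proof. by move=> c a b; apply/ffunP=> x; rewrite !ffunE mulrDr. Qed.
Fact galg_scaleDl a : {morph galg_scale^~ a : c d / c + d}.
Proof. by move=> c d; apply/ffunP=> x; rewrite !ffunE mulrDl. Qed.

HB.instance Definition _ := GRing.Zmodule_isLmodule.Build R RG
  galg_scaleA galg_scale1 galg_scaleDr galg_scaleDl.

End GroupAlg.

Definition galg_int_rat (gT : finGroupType) (h : group_alg int gT) :
  group_alg rat gT := [ffun x => (h x)%:~R].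

Definition dsum (k : nat) (S : 'I_k -> pzRingType) := {dffun forall i, S i}.

Section DirectSum.
Variables (k : nat) (S : 'I_k -> pzRingType).
Local Notation T := (dsum S).

HB.instance Definition _ := Choice.on T.

Definition dsum_zero : T := [ffun i => 0].
Definition dsum_one : T := [ffun i => 1].
Definition dsum_opp (a : T) : T := [ffun i => - a i].
Definition dsum_add (a b : T) : T := [ffun i => a i + b i].
Definition dsum_mul (a b : T) : T := [ffun i => a i * b i].

Fact dsum_addA : associative dsum_add.
Proof. by move=> a b c; apply/ffunP=> i; rewrite !ffunE addrA. Qed.
Fact dsum_addC : commutative dsum_add.
Proof. by move=> a b; apply/ffunP=> i; rewrite !ffunE addrC. Qed.
Fact dsum_add0 : left_id dsum_zero dsum_add.
Proof. by move=> a; apply/ffunP=> i; rewrite !ffunE add0r. Qed.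
Fact dsum_addN : left_inverse dsum_zero dsum_opp dsum_add.
Proof. by move=> a; apply/ffunP=> i; rewrite !ffunE addNr. Qed.

HB.instance Definition _ := GRing.isZmodule.Build T
  dsum_addA dsum_addC dsum_add0 dsum_addN.

Fact dsum_mulA : associative dsum_mul.
Proof. by move=> a b c; apply/ffunP=> i; rewrite !ffunE mulrA. Qed.
Fact dsum_mul1 : left_id dsum_one dsum_mul.
Proof. by move=> a; apply/ffunP=> i; rewrite !ffunE mul1r. Qed.
Fact dsum_mulr1 : right_id dsum_one dsum_mul.
Proof. by move=> a; apply/ffunP=> i; rewrite !ffunE mulr1. Qed.
Fact dsum_mulDl : left_distributive dsum_mul dsum_add.
Proof. by move=> a b c; apply/ffunP=> i; rewrite !ffunE mulrDl. Qed.
Fact dsum_mulDr : right_distributive dsum_mul dsum_add.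
Proof. by move=> a b c; apply/ffunP=> i; rewrite !ffunE mulrDr. Qed.

HB.instance Definition _ := GRing.Zmodule_isPzRing.Build T
  dsum_mulA dsum_mul1 dsum_mulr1 dsum_mulDl dsum_mulDr.

End DirectSum.

(* The ring Z[z] and the field Q(z), as a subring and a subfield of algC.  In
   in_Qadj no condition q.[z] != 0 is needed, since x / 0 = 0. *)
Definition in_Zadj (z : algC) : {pred algC} := fun x =>
  `[< exists p : {poly int}, x = (map_poly intr p).[z] >].

Definition in_Qadj (z : algC) : {pred algC} := fun x =>
  `[< exists p q : {poly rat},
        x = (map_poly ratr p).[z] / (map_poly ratr q).[z] >].

Fact in_Zadj_subring z : subring_closed (in_Zadj z).
Proof.
split.
- by apply/asboolP; exists 1; rewrite rmorph1 hornerC.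
- move=> _ _ /asboolP[p ->] /asboolP[q ->]; apply/asboolP; exists (p - q).
  by rewrite rmorphB hornerD hornerN.
- move=> _ _ /asboolP[p ->] /asboolP[q ->]; apply/asboolP; exists (p * q).
  by rewrite rmorphM hornerM.
Qed.

HB.instance Definition _ z :=
  GRing.isSubringClosed.Build algC (in_Zadj z) (in_Zadj_subring z).

Fact in_Qadj_divring z : divring_closed (in_Qadj z).
Proof.
split.
- by apply/asboolP; exists 1, 1; rewrite rmorph1 hornerC divr1.
- move=> _ _ /asboolP[p [q ->]] /asboolP[r [s ->]]; apply/asboolP.
  have [->|nq] := eqVneq (map_poly ratr q).[z] 0.
    by exists (- r), s; rewrite rmorphN hornerN invr0 mulr0 sub0r mulNr.
  have [->|ns] := eqVneq (map_poly ratr s).[z] 0.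
    by exists p, q; rewrite invr0 mulr0 subr0.
  exists (p * s - r * q), (q * s).
  by rewrite rmorphB !rmorphM hornerD hornerN !hornerM -mulNr addf_div // mulNr.
- move=> _ _ /asboolP[p [q ->]] /asboolP[r [s ->]]; apply/asboolP.
  exists (p * s), (q * r).
  by rewrite !rmorphM !hornerM invf_div mulf_div.
Qed.

HB.instance Definition _ z :=
  GRing.isDivringClosed.Build algC (in_Qadj z) (in_Qadj_divring z).

Definition Zadj (z : algC) := {x : algC | x \in in_Zadj z}.
HB.instance Definition _ z := SubChoice.on (Zadj z).
HB.instance Definition _ z := [SubChoice_isSubComNzRing of Zadj z by <:].

Definition Qadj (z : algC) := {x : algC | x \in in_Qadj z}.
HB.instance Definition _ z := SubChoice.on (Qadj z).
HB.instance Definition _ z := [SubChoice_isSubIntegralDomain of Qadj z by <:].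
HB.instance Definition _ z := [SubIntegralDomain_isSubField of Qadj z by <:].

Fact Zadj_sub_Qadj z : {subset in_Zadj z <= in_Qadj z}.
Proof.
move=> _ /asboolP[p ->]; apply/asboolP; exists (map_poly intr p), 1.
rewrite rmorph1 hornerC divr1 -map_poly_comp; congr (_.[z]).
by apply: eq_map_poly => x /=; rewrite ratr_int.
Qed.

Definition Zadj_Qadj z (x : Zadj z) : Qadj z :=
  Sub (val x) (Zadj_sub_Qadj (valP x)).

Section Characters.
Variable gT : finGroupType.
Local Notation G := [set: gT].

(* K is a number field, iota an embedding of it in the complex numbers, and
   chiK is chi1 viewed as a K-valued function. *)
Definition alg_conj (chi1 chi2 : 'CF(G)) : Prop :=
  exists (K : splittingFieldType rat) (iota : {rmorphism K -> algC})
         (chiK : gT -> K) (s : gal_of {:K}),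
    [/\ galois 1 {:K}, s \in 'Gal({:K} / 1),
        forall x, chi1 x = iota (chiK x)
      & forall x, chi2 x = iota (s (chiK x))].

Definition pairwise_nonconj (S : {set Iirr G}) : Prop :=
  {in S &, forall i j, i != j -> ~ alg_conj 'chi_i 'chi_j}.

Definition char_ext (chi : 'CF(G)) (h : group_alg rat gT) : algC :=
  \sum_(x : gT) ratr (h x) * chi x.

Hypothesis abelG : abelian G.
Variable zeta : nat -> algC.
Hypothesis zetaP : forall q, (0 < q)%N -> q.-primitive_root (zeta q).

Fact char_ext_Qadj i h :
  char_ext 'chi_i h \in in_Qadj (zeta #['chi_i]%CF).
Proof.
have lin : 'chi_i \is a linear_char by apply/char_abelianP.
have prim := zetaP (cforder_lin_char_gt0 lin).
apply: (@rpred_sum _ (in_Qadj _)) => x _; apply: rpredM.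
  apply/asboolP; exists (h x)%:P, 1.
  by rewrite rmorph1 map_polyC !hornerC divr1.
have /(prim_rootP prim)[j ->] : 'chi_i x ^+ #['chi_i]%CF = 1.
  by have /dvdn_cforderP := dvdnn #['chi_i]%CF; apply; rewrite inE.
apply: rpredX; apply/asboolP; exists 'X, 1.
by rewrite rmorph1 map_polyX hornerX hornerC divr1.
Qed.

(* h |-> (chi_1(h), ..., chi_k(h)), where #['chi_i]%CF is the order of 'chi_i
   in the character group. *)
Definition chars_map k (chi : 'I_k -> Iirr G) (h : group_alg rat gT) :
    dsum (fun i => Qadj (zeta #['chi_(chi i)]%CF)) :=
  [ffun i => Sub (char_ext 'chi_(chi i) h) (char_ext_Qadj (chi i) h)].

End Characters.

(* Main.v *)
(* With c_i = sigma_i(c_{k_i}) for i > k, the vector (c_1, ..., c_n) attached to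
   h is A times the coefficient vector of h, because each sigma_i fixes the
   integers and carries the character of index k_i to the one of index i.  The
   matrix A is invertible by the first orthogonality relation, so psi(h)
   determines h, and A^-1 recovers its coefficients. *)

Require Import Defs.
From HB Require Import structures.
From mathcomp Require Import all_boot all_order all_algebra all_fingroup.
From mathcomp Require Import all_solvable all_field all_character.
From mathcomp Require Import boolp.

Set Implicit Arguments.
Unset Strict Implicit.
Unset Printing Implicit Defensive.

Import Order.TTheory GroupScope GRing.Theory Num.Theory.
Local Open Scope ring_scope.

Section IntegralCharacterSums.
Variable gT : finGroupType.
Local Notation G := [set: gT].

(** Values are kept in [algC], not in a ring [Zadj] depending on the character, so that all n
    characters can be compared within one matrix identity. *)
Definition char_int_ext (chi : 'CF(G)) (h : group_alg int gT) : algC :=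
  \sum_(x : gT) (h x)%:~R * chi x.

Lemma char_ext_int_rat (chi : 'CF(G)) (h : group_alg int gT) :
  char_ext chi (galg_int_rat h) = char_int_ext chi h.
Proof. by apply: eq_bigr => x _; rewrite ffunE ratr_int. Qed.

Lemma char_ext_elt (chi : 'CF(G)) (x : gT) :
  char_ext chi (galg_elt rat x) = chi x.
Proof.
rewrite /char_ext (bigD1 x) //= big1 => [|y ny].
  by rewrite ffunE eqxx rmorph1 mul1r addr0.
by rewrite ffunE (negPf ny) rmorph0 mul0r.
Qed.

Lemma char_int_extB (chi : 'CF(G)) : {morph char_int_ext chi : a b / a - b}.
Proof.
move=> a b; rewrite -sumrB; apply: eq_bigr => x _.
by rewrite !ffunE rmorphB mulrBl.
Qed.

Lemma char_int_ext1 (chi : 'CF(G)) :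
  chi \is a linear_char -> char_int_ext chi 1 = 1.
Proof.
move=> lin; rewrite /char_int_ext (bigD1 1%g) //= big1 => [|x nx].
  by rewrite ffunE eqxx mul1r lin_char1 // addr0.
by rewrite ffunE (negPf nx) mul0r.
Qed.

(** A linear character is multiplicative on the group, so substituting [y * z] for the summation
    variable splits the convolution into a product of two sums. *)
Lemma char_int_extM (chi : 'CF(G)) :
  chi \is a linear_char -> {morph char_int_ext chi : a b / a * b}.
Proof.
move=> lin a b; rewrite /char_int_ext mulr_suml.
under eq_bigr => x _ do rewrite ffunE rmorph_sum mulr_suml.
rewrite exchange_big; apply: eq_bigr => y _ /=.
rewrite mulr_sumr (reindex_inj (mulgI y)); apply: eq_bigr => z _ /=.
by rewrite mulKg lin_charM ?inE // rmorphM mulrACA.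
Qed.

Section Enumeration.
Variables (n : nat) (g : 'I_n -> gT).
Hypothesis g_bij : bijective g.

Lemma galg_sumE (h : 'I_n -> int) (j : 'I_n) :
  (\sum_i h i *: galg_elt int (g i)) (g j) = h j.
Proof.
rewrite sum_ffunE (bigD1 j) //= big1 => [|i ni].
  by rewrite !ffunE eqxx mulr1 addr0.
by rewrite !ffunE (inj_eq (bij_inj g_bij)) eq_sym (negPf ni) mulr0.
Qed.

Lemma galg_sum (a : group_alg int gT) :
  a = \sum_j a (g j) *: galg_elt int (g j).
Proof.
have [g' _ g'K] := g_bij; apply/ffunP=> x; rewrite -(g'K x).
by rewrite (galg_sumE (fun j => a (g j))).
Qed.

(** This form, with the character value first, is an entry of the product of the character matrix
    with the coefficient column. *)
Lemma char_int_ext_enum (chi : 'CF(G)) (a : group_alg int gT) :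
  char_int_ext chi a = \sum_j chi (g j) * (a (g j))%:~R.
Proof.
rewrite /char_int_ext (reindex g) /=; last exact: onW_bij.
by apply: eq_bigr => j _; rewrite mulrC.
Qed.

Lemma char_matrix_unit (chi : 'I_n -> Iirr G) : bijective chi ->
  \matrix_(i, j) 'chi_(chi i) (g j) \in unitmx.
Proof.
move=> chi_bij.
(* The candidate inverse is the conjugate transpose divided by the group order: entry (i, j) of the
   product is then the inner product of the characters [chi i] and [chi j]. *)
pose A' : 'M[algC]_n := \matrix_(j, i) (#|G|%:R^-1 * ('chi_(chi i) (g j))^*).
apply: (proj1 (@mulmx1_unit _ _ _ A' _)).
apply/matrixP=> i j; rewrite !mxE -(inj_eq (bij_inj chi_bij)) -cfdot_irr.
rewrite cfdotE big_distrr /= [RHS](reindex g) /=; last exact: onW_bij.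
rewrite [RHS](eq_bigl xpredT) => [|l]; last by rewrite inE.
by apply: eq_bigr => l _; rewrite !mxE mulrCA.
Qed.

End Enumeration.

Hypothesis abelG : abelian G.
Variable zeta : nat -> algC.
Hypothesis zetaP : forall q, (0 < q)%N -> q.-primitive_root (zeta q).

(** The values of ['chi_i] are roots of unity killed by the order of ['chi_i], hence powers of the
    chosen primitive root; integer combinations of these stay in the ring it generates. *)
Lemma char_int_ext_Zadj i h :
  char_int_ext 'chi_i h \in in_Zadj (zeta #['chi_i]%CF).
Proof.
have lin : 'chi_i \is a linear_char by apply/char_abelianP.
have prim := zetaP (cforder_lin_char_gt0 lin).
apply: (@rpred_sum _ (in_Zadj _)) => x _; apply: rpredM; first exact: rpred_int.
have /(prim_rootP prim)[j ->] : 'chi_i x ^+ #['chi_i]%CF = 1.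
  by have /dvdn_cforderP := dvdnn #['chi_i]%CF; apply; rewrite inE.
by apply: rpredX; apply/asboolP; exists 'X; rewrite map_polyX hornerX.
Qed.

Section IntegralCharsMap.
Variables (k : nat) (chi : 'I_k -> Iirr G).

(** Built directly over [Zadj] to have the integral codomain; [int_chars_map_rat] identifies it with
    the restriction of [chars_map]. *)
Definition int_chars_map (h : group_alg int gT) :
    dsum (fun i => Zadj (zeta #['chi_(chi i)]%CF)) :=
  [ffun i => Sub (char_int_ext 'chi_(chi i) h) (char_int_ext_Zadj (chi i) h)].

Lemma val_int_chars_map h i :
  val (int_chars_map h i) = char_int_ext 'chi_(chi i) h.
Proof. by rewrite ffunE SubK. Qed.

Fact int_chars_map_zmod_morphism : zmod_morphism int_chars_map.
Proof.
move=> a b; apply/ffunP=> i; apply: val_inj.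
by rewrite val_int_chars_map !ffunE /= char_int_extB.
Qed.

Fact int_chars_map_monoid_morphism : monoid_morphism int_chars_map.
Proof.
have lin i : 'chi_(chi i) \is a linear_char by apply/char_abelianP.
split=> [|a b]; apply/ffunP=> i; apply: val_inj; rewrite val_int_chars_map.
  by rewrite ffunE char_int_ext1.
by rewrite !ffunE /= char_int_extM.
Qed.

HB.instance Definition _ :=
  GRing.isZmodMorphism.Build _ _ int_chars_map int_chars_map_zmod_morphism.
HB.instance Definition _ :=
  GRing.isMonoidMorphism.Build _ _ int_chars_map int_chars_map_monoid_morphism.

Lemma int_chars_map_rat h i :
  Zadj_Qadj (int_chars_map h i) = chars_map abelG zetaP chi (galg_int_rat h) i.
Proof. by apply: val_inj; rewrite !ffunE /= char_ext_int_rat. Qed.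

Lemma conj_char_int_ext (i : 'I_k) (chi' : 'CF(G))
    (s : {rmorphism Qadj (zeta #['chi_(chi i)]%CF) ->
                    Qadj (zeta #['chi_(chi i)]%CF)}) :
    (forall x,
      val (s (chars_map abelG zetaP chi (galg_elt rat x) i)) = chi' x) ->
  forall h, val (s (Zadj_Qadj (int_chars_map h i))) = char_int_ext chi' h.
Proof.
move=> sP h.
(* The expansion over group elements must take place inside [Qadj], the domain of [s]; then [s]
   passes through the sum and fixes the integer coefficients. *)
have -> : Zadj_Qadj (int_chars_map h i) =
    \sum_x (h x)%:~R * chars_map abelG zetaP chi (galg_elt rat x) i.
  apply: val_inj; rewrite ffunE [LHS]/= rmorph_sum.
  by apply: eq_bigr => x _; rewrite rmorphM rmorph_int ffunE /= char_ext_elt.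
rewrite !rmorph_sum; apply: eq_bigr => x _.
by rewrite !rmorphM !rmorph_int /= sP.
Qed.

End IntegralCharsMap.

End IntegralCharacterSums.

Theorem proposition3p4
    (gT : finGroupType) (abelG : abelian [set: gT])
    (k m : nat)
    (g : 'I_(k + m) -> gT) (g_bij : bijective g)
    (chi : 'I_(k + m) -> Iirr [set: gT]) (chi_bij : bijective chi)
    (chi_max : maxset (fun S => `[< pairwise_nonconj S >])
                      [set chi (lshift m i) | i : 'I_k])
    (zeta : nat -> algC)
    (zetaP : forall q, (0 < q)%N -> q.-primitive_root (zeta q))
    (kk : 'I_m -> 'I_k)
    (kkP : forall i, alg_conj 'chi_(chi (lshift m (kk i)))
                              'chi_(chi (rshift k i))) :
  let q (i : 'I_k) := #['chi_(chi (lshift m i))]%CF in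
  let phi := chars_map abelG zetaP (fun i : 'I_k => chi (lshift m i)) in
  let A : 'M[algC]_(k + m) := \matrix_(i, j) 'chi_(chi i) (g j) in
  let B : 'M[algC]_(k, k + m) := usubmx A in
  forall (sigma : forall i : 'I_m,
            {rmorphism Qadj (zeta (q (kk i))) -> Qadj (zeta (q (kk i)))})
         (sigma_bij : forall i, bijective (sigma i))
         (sigmaP : forall i x, val (sigma i (phi (galg_elt rat x) (kk i)))
                               = 'chi_(chi (rshift k i)) x),
  exists psi : {rmorphism group_alg int gT ->
                          dsum (fun i : 'I_k => Zadj (zeta (q i)))},
    [/\ forall h i, Zadj_Qadj (psi h i) = phi (galg_int_rat h) i,
        injective psi,
        forall h : 'I_(k + m) -> int,
          \col_i val (psi (\sum_j h j *: galg_elt int (g j)) i)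
          = B *m \col_j (h j)%:~R
      & forall c : dsum (fun i : 'I_k => Zadj (zeta (q i))),
          (exists a, psi a = c) ->
          exists h : 'I_(k + m) -> int,
            (forall a, psi a = c <-> a = \sum_j h j *: galg_elt int (g j)) /\
            \col_j (h j)%:~R
            = invmx A *m col_mx (\col_i val (c i))
                           (\col_i val (sigma i (Zadj_Qadj (c (kk i)))))].
Proof.
move=> q phi A B sigma sigma_bij sigmaP.
pose psi := int_chars_map abelG zetaP (fun i : 'I_k => chi (lshift m i)).
(* The completed vector of the inversion formula, with the entries beyond k obtained by
   conjugation. *)
pose cc (c : dsum (fun i : 'I_k => Zadj (zeta (q i)))) : 'cV[algC]_(k + m) :=
  col_mx (\col_i val (c i)) (\col_i val (sigma i (Zadj_Qadj (c (kk i))))).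
have A_unit : A \in unitmx by apply: char_matrix_unit.
have AP (a : group_alg int gT) : A *m \col_j (a (g j))%:~R = cc (psi a).
  apply/colP=> i; rewrite !mxE.
  transitivity (char_int_ext 'chi_(chi i) a).
    by rewrite (char_int_ext_enum g_bij); apply: eq_bigr => j _; rewrite !mxE.
  (* The first k rows hold by construction of [psi]; in the last m rows [sigmaP] gives the
     conjugation on group elements, and hence on all of the integral group ring. *)
  rewrite -(splitK i); case: (split i) => {}i /=.
    by rewrite (unsplitK (inl i)) mxE val_int_chars_map.
  by rewrite (unsplitK (inr i)) mxE (conj_char_int_ext (sigmaP i)).
have psiK (a : group_alg int gT) : \col_j (a (g j))%:~R = invmx A *m cc (psi a).
  by rewrite -AP mulKmx.
have psi_inj : injective psi.
  (* Equal images give equal coefficient columns over [algC], and the integers embed injectively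
     there. *)
  move=> a b eq_ab; have := psiK a; rewrite eq_ab -psiK => /colP e.
  rewrite (galg_sum g_bij a) (galg_sum g_bij b); apply: eq_bigr => j _.
  by have := e j; rewrite !mxE => /intr_inj->.
exists psi; split=> // [h i|h|c [a <-]].
- exact: int_chars_map_rat.
(* The formula with [B] is the upper block of [AP]. *)
- set a := \sum_j _; have := congr1 usubmx (AP a).
  rewrite -mul_usub_mx col_mxKu => <-; congr (_ *m _).
  by apply/colP=> j; rewrite !mxE galg_sumE.
(* The witness is the coefficient family of a preimage [a], which injectivity makes the only one. *)
- exists (fun j => a (g j)); split; last exact: psiK.
  by move=> b; rewrite -(galg_sum g_bij a); split=> [/psi_inj|->].
Qed.
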